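(* Let $B$ be standard Brownian motion, let $\rho(t)\ge 0$ be an increasing, differentiable function of $t\ge 0$ with $\rho(0)=0$, and let $Z(t)=z+B(\rho(t))$. Let $z<a$. For $n\ge 1$ let $\tau_n(z)$ be the successive passage times of $Z$ through the constant barrier $S=a$, and let $T_n(z)=\tau_n(z)-\tau_{n-1}(z)$ be the inter-passage times. Let $\tau^B_n(z)$ be the $n$-th passage time through $a$ of Brownian motion starting from $z$. Then $$\tau_n(z)=\rho^{-1}(\tau_n^B(z))\quad\text{and}\quad T_n(z)=\rho^{-1}(\tau_n^B(z))-\rho^{-1}(\tau_{n-1}^B(z)),\qquad n\ge 1.$$ Thus the calculation of the distributions of $\tau_n(z)$ and $T_n(z)$ is reduced to that of the distributions of $\tau_n^B(z)$ and $T_n^B(z)$, where $T_n^B(z)=\tau_n^B(z)-\tau_{n-1}^B(z)$.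
   Context: The passage times are $\tau_1(z)=\inf\{t>0: z+B(\rho(t))=a\}$ and, for $n\ge 2$, $\tau_n(z)=\inf\{t>\tau_{n-1}(z): z+B(\rho(t))=a\}$; likewise $\tau_1^B(z)=\inf\{s>0: z+B_s=a\}$ and, for $n\ge 2$, $\tau_n^B(z)=\inf\{s>\tau^B_{n-1}(z): z+B_s=a\}$. For $n=1$ the inter-passage times are $T_1(z)=\tau_1(z)$ and $T_1^B(z)=\tau_1^B(z)$, i.e. the terms with index $n-1=0$ are absent. $\rho^{-1}$ denotes the inverse function of $\rho$. *)

(* Defs.v *)
From HB Require Import structures.
From mathcomp Require Import all_boot all_order all_algebra.
From mathcomp Require Import all_classical all_reals all_analysis.
From mathcomp Require Import measurable_realfun.
Set Implicit Arguments.
Unset Strict Implicit.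
Unset Printing Implicit Defensive.
Import Order.TTheory GRing.Theory Num.Theory.
Import numFieldNormedType.Exports.
Local Open Scope classical_set_scope.
Local Open Scope ring_scope.

(* Time-indexed objects are functions of a real argument of which only the
   restriction to [0, +oo[ is constrained or used. *)

(* [normal_prob m s] is parameterized by the standard deviation [s].
   Independence is stated for n consecutive increments; taking [A i := setT]
   gives the product rule for every subfamily. *)
Record standard_brownian_motion d (T : measurableType d) (R : realType)
    (P : probability T R) (B : R -> T -> R) : Prop := {
  bm_measurable : forall t : R, 0 <= t -> measurable_fun setT (B t) ;
  bm_start : forall w, B 0 w = 0 ;
  bm_gaussian : forall s t : R, 0 <= s -> s < t ->
    forall A : set R, measurable A ->
      P [set w | A (B t w - B s w)] = normal_prob 0 (Num.sqrt (t - s)) A ;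
  bm_independent : forall (n : nat) (t : nat -> R) (A : nat -> set R),
    0 <= t 0%N -> {homo t : i j / (i <= j)%N >-> i <= j} ->
    (forall i, measurable (A i)) ->
    P [set w | forall i, (i < n)%N -> A i (B (t i.+1) w - B (t i) w)] =
    (\prod_(i < n) P [set w | A i (B (t i.+1) w - B (t i) w)%R])%E ;
  bm_continuous : forall w, {within `[0, +oo[, continuous (fun t => B t w)}
}.

(* The derivative at 0 is one-sided. *)
Definition differentiable_on_nonneg (R : realType) (f : R -> R) : Prop :=
  (forall t : R, 0 < t -> derivable f t 1) /\
  cvg ((f h - f 0) / h @[h --> 0^'+]).

(* [passage_time a x n] is the n-th passage time, for n >= 1, of the path [x]
   through the level [a]; it is +oo when the infimum is over the empty set.
   The value 0 at index 0 only serves to start the recursion, so that the first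
   passage time is inf {t > 0 | x t = a}. *)
Fixpoint passage_time (R : realType) (a : R) (x : R -> R) (n : nat) : \bar R :=
  if n is m.+1 then
    ereal_inf [set t%:E | t in [set t | (passage_time a x m < t%:E)%E /\ x t = a]]
  else 0%E.

(* In the dual extended-real subtraction +oo - +oo = +oo: a passage that never
   occurs has infinite inter-passage time. *)
Definition interpassage_time (R : realType) (a : R) (x : R -> R) (n : nat) :
    \bar R :=
  if (n <= 1)%N then passage_time a x n
  else (passage_time a x n - passage_time a x n.-1)%dE.

(* The inverse of rho : [0, +oo[ -> R, with value +oo outside the range of rho;
   in particular, for increasing continuous rho with rho 0 = 0, the value is +oo
   from sup rho (included) up to +oo. *)
Definition time_inverse (R : realType) (rho : R -> R) (s : \bar R) : \bar R :=
  if s is r%:E then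
    if r \in rho @` `[0, +oo[ then ('pinv_(fun=> 0) `[0, +oo[ rho r)%:E
    else +oo%E
  else +oo%E.

(* X and Y are random elements, g is Borel, and the distribution of X is the
   image under g of the distribution of Y. *)
Definition distribution_image d d1 d2 (T : measurableType d)
    (T1 : measurableType d1) (T2 : measurableType d2) (R : realType)
    (P : probability T R) (X : T -> T2) (g : T1 -> T2) (Y : T -> T1) : Prop :=
  [/\ measurable_fun setT X, measurable_fun setT Y, measurable_fun setT g &
      forall A, measurable A ->
        pushforward P X A = pushforward (pushforward P Y) g A].

(* Main.v *)
Require Import Defs.
From HB Require Import structures.
From mathcomp Require Import all_boot all_order all_algebra.
From mathcomp Require Import all_classical all_reals all_analysis.
From mathcomp Require Import measurable_realfun.
Set Implicit Arguments.
Unset Strict Implicit.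
Unset Printing Implicit Defensive.
Import Order.TTheory GRing.Theory Num.Theory.
Import numFieldNormedType.Exports.
Local Open Scope classical_set_scope.
Local Open Scope ring_scope.

(** The identities hold path by path: rho is a continuous increasing bijection
    from [0, +oo[ onto [0, sup rho[, and [tau_n < c] iff [0 < c] and
    [tau_n^B < rho c], by induction on n; this is exactly when
    [rho^-1 (tau_n^B) < c], and an extended real is determined by the finite
    numbers above it. For the distributions, the passage times of a measurable
    process with continuous paths are random variables, because the event that
    the level is hit during a compact interval involves only countably many
    times. *)

(** * Strict bounds on extended reals and on passage times *)

Lemma eq_ereal_lt_fin (R : realType) (x y : \bar R) :
  (forall c : R, (x < c%:E)%E <-> (y < c%:E)%E) -> x = y.
Proof.
wlog : x y / (x <= y)%E => [hw xy|].
  case/orP: (le_total x y) => [|yx]; first by move/hw; exact.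
  by apply/esym/hw => // c; split => /xy.
rewrite le_eqVlt => /orP[/eqP//|xy] h.
(* A real [c] with [x < c <= y] contradicts [h]: it is [y] when [y] is finite, [x + 1] when only [x]
   is, and [0] when neither is. *)
case: y x xy h => [y| |] [x| |] // xy h.
- by have := (h y).1 xy; rewrite ltxx.
- by have := (h y).1 (ltNyr y); rewrite ltxx.
- by have := (h (x + 1)).1; rewrite lte_fin ltrDl ltr01 => /(_ isT).
- by have := (h 0).1 (ltNyr 0).
Qed.

(** With strict bounds the question whether the infimum is attained does not arise: it is below [c]
    exactly when some element of the set is. *)
Lemma passage_timeS_lt (R : realType) (a : R) (x : R -> R) n (c : R) :
  (passage_time a x n.+1 < c%:E)%E <->
  exists t, [/\ (passage_time a x n < t%:E)%E, t < c & x t = a].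
Proof.
split=> [/ereal_inf_lt[_ [t [nt xt] <-] tc]|[t [nt tc xt]]].
  by exists t; split.
apply: le_lt_trans (_ : (t%:E < c%:E)%E); last by rewrite lte_fin.
by apply: ereal_inf_lbound; exists t.
Qed.

Lemma passage_time_leS (R : realType) (a : R) (x : R -> R) n :
  (passage_time a x n <= passage_time a x n.+1)%E.
Proof. by apply: le_ereal_inf_tmp => _ [t [nt _] <-]; exact: ltW. Qed.

Lemma passage_time_ge0 (R : realType) (a : R) (x : R -> R) n :
  (0 <= passage_time a x n)%E.
Proof. by elim: n => // n ih; apply: le_trans ih _; exact: passage_time_leS. Qed.

(** * Deterministic time change of a path *)

Section TimeChange.
Variables (R : realType) (rho : R -> R).
Hypothesis rho_incr : {in `[0, +oo[ &, {homo rho : s t / s < t}}.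
Hypothesis rho0 : rho 0 = 0.

Lemma le_time_change : {in `[0, +oo[ &, {mono rho : s t / s <= t}}.
Proof. exact: le_mono_in. Qed.

Lemma lt_time_change : {in `[0, +oo[ &, {mono rho : s t / s < t}}.
Proof. exact: leW_mono_in le_time_change. Qed.

Lemma time_inverseK t : 0 <= t -> time_inverse rho (rho t)%:E = t%:E.
Proof.
move=> t0; rewrite /time_inverse ifT; last first.
  by apply/mem_set; exists t => //=; rewrite in_itv/= t0.
congr EFin; apply: pinvKV; last by rewrite inE/= in_itv/= t0.
move=> u v /[!inE]/= u0 v0; exact: (inc_inj_in le_time_change).
Qed.

Lemma differentiable_on_nonneg_continuous : differentiable_on_nonneg rho ->
  {within `[0, +oo[, continuous rho}.
Proof.
move=> [drho /cvg_ex[/= l rhol]].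
apply: derivable_oy_Rcontinuous_within_itvcy; split=> [t|].
  by rewrite in_itv/= andbT; exact: drho.
have h0 : h @[h --> (0:R)^'+] --> (0:R) by exact: cvg_within.
(* Right continuity at 0: [rho h] is the difference quotient, which converges, times [h]. *)
have : (rho h - rho 0) / h * h @[h --> 0^'+] --> l * 0 by exact: cvgM.
rewrite mulr0 rho0; apply: cvg_trans; apply: near_eq_cvg; near=> h.
by rewrite subr0 mulfVK.
Unshelve. all: by end_near. Qed.

Hypothesis rho_cont : {within `[0, +oo[, continuous rho}.

Lemma time_change_surj c s : 0 <= c -> 0 <= s <= rho c ->
  exists2 t, 0 <= t <= c & rho t = s.
Proof.
move=> c0 /andP[s0 sc].
have : {within `[0, c], continuous rho}.
  apply: continuous_subspaceW rho_cont => t /=.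
  by rewrite !in_itv/= andbT => /andP[].
move=> /(@IVT _ _ _ _ s c0)[].
  by rewrite rho0 min_l ?max_r ?s0// (le_trans s0).
by move=> t; rewrite in_itv/= => tc ts; exists t.
Qed.

(** A finite value of the inverse means that [s = rho t] with [0 <= t], and [rho] preserves and
    reflects order there. Conversely, the intermediate value theorem puts every [s] in [[0, rho c[]
    in the range of [rho]. *)
Lemma time_inverse_lt (s : \bar R) (c : R) :
  (time_inverse rho s < c%:E)%E <-> 0 < c /\ (0 <= s < (rho c)%:E)%E.
Proof.
split.
  case: s => [s| |] //=; case: ifPn; last by [].
  move=> /[!inE] -[t]; rewrite /= in_itv/= andbT => t0 <-.
  have := time_inverseK t0; rewrite /= ifT; last first.
    by rewrite inE; exists t => //=; rewrite in_itv/= t0.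
  move=> ->; rewrite lte_fin => tc; have c0 := le_lt_trans t0 tc.
  split => //; apply/andP; split; rewrite ?lee_fin ?lte_fin.
    by rewrite -rho0 le_time_change ?in_itv//= ?t0// lexx.
  by rewrite lt_time_change ?in_itv/= ?t0// ltW.
move=> [c0]; case: s => [s| |] //; last by move=> /andP[].
rewrite lee_fin lte_fin => /andP[s0 sc].
have [||t /andP[t0 tc] ts] := @time_change_surj c s; first exact: ltW.
  by rewrite s0 ltW.
rewrite -ts time_inverseK// lte_fin -lt_time_change ?in_itv/= ?andbT ?ts//.
exact: ltW.
Qed.

(** A hit of the changed path at [t] is a hit of [x] at [rho t]. The bound [c] stays general in the
    induction because the hypothesis is applied with the hitting time [t] in its place. *)
Lemma passage_time_change_lt (a : R) (x : R -> R) n (c : R) :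
  (passage_time a (x \o rho) n < c%:E)%E <->
  0 < c /\ (passage_time a x n < (rho c)%:E)%E.
Proof.
elim: n c => [c|n ih c].
  rewrite /= !lte_fin; split => [c0|[]//]; split => //.
  by rewrite -rho0 lt_time_change ?in_itv/= ?lexx ?ltW.
rewrite !passage_timeS_lt; split => [[t [/ih[t0 nt] tc xt]]|[c0]].
  have c0 := lt_trans t0 tc; split => //; exists (rho t); split => //.
  by rewrite lt_time_change// in_itv/= ltW.
move=> [s [ns sc xs]].
have s0 : 0 < s by rewrite -lte_fin (le_lt_trans (passage_time_ge0 a x n)).
have [||t /andP[t0 tc] ts] := @time_change_surj c s; first exact: ltW.
  by rewrite !ltW.
exists t; split; [apply/ih; split| |by rewrite /= ts].
- by rewrite -lt_time_change ?in_itv/= ?lexx ?t0// rho0 ts.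
- by rewrite ts.
- by rewrite -lt_time_change ?in_itv/= ?t0 ?ts// ltW.
Qed.

Lemma passage_time_change (a : R) (x : R -> R) n :
  passage_time a (x \o rho) n = time_inverse rho (passage_time a x n).
Proof.
apply: eq_ereal_lt_fin => c.
by rewrite passage_time_change_lt time_inverse_lt passage_time_ge0.
Qed.

Lemma interpassage_time_change1 (a : R) (x : R -> R) :
  interpassage_time a (x \o rho) 1 = time_inverse rho (passage_time a x 1).
Proof. exact: passage_time_change. Qed.

Lemma interpassage_time_changeS (a : R) (x : R -> R) n : (2 <= n)%N ->
  interpassage_time a (x \o rho) n =
  (time_inverse rho (passage_time a x n) -
   time_inverse rho (passage_time a x n.-1))%dE.
Proof. by move=> n2; rewrite /interpassage_time leqNgt n2 !passage_time_change. Qed.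

(** This makes the inter-passage time a function of the pair formed by the passage time and the
    inter-passage time of [x]: their difference recovers the preceding passage time. If the passage
    time is infinite, the ordinary difference is -oo, its inverse is +oo, and both sides are still
    +oo by the dual convention. *)
Lemma interpassage_time_changeE (a : R) (x : R -> R) n : (1 <= n)%N ->
  interpassage_time a (x \o rho) n =
  (time_inverse rho (passage_time a x n) -
   time_inverse rho (passage_time a x n - interpassage_time a x n)%E)%dE.
Proof.
have rhoV0 : time_inverse rho 0%:E = 0%:E
  by have := time_inverseK (lexx 0); rewrite rho0.
case: n => [//|[|n]] _.
  have -> : interpassage_time a x 1 = passage_time a x 1 by [].
  rewrite interpassage_time_change1.
  case: (passage_time a x 1) (passage_time_ge0 a x 1) => [r| |]// _.
  rewrite -EFinB subrr rhoV0.
  by case: (time_inverse _ _) => [u| |]//; rewrite -DualAddTheoryNumDomain.dEFinB subr0.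
have -> : interpassage_time a x n.+2 =
  (passage_time a x n.+2 - passage_time a x n.+1)%dE by [].
rewrite interpassage_time_changeS// succnK.
(* When the later passage time is finite, these two bounds force the earlier one to be finite. *)
have := passage_time_leS a x n.+1.
have := passage_time_ge0 a x n.+1.
case: (passage_time a x n.+2) (passage_time a x n.+1) => [r| |] [s| |]//.
by rewrite -DualAddTheoryNumDomain.dEFinB -EFinB subKr.
Qed.

(** The preimage of an open lower ray is empty or an interval [[0, rho c[]. *)
Lemma measurable_time_inverse : measurable_fun setT (time_inverse rho).
Proof.
apply: (measurability _ (@ErealGenInftyO.measurableE R)) => _ [_ [c ->] <-].
rewrite setTI; have [c0|c0] := ltP 0 c; last first.
  rewrite (_ : _ @^-1` _ = set0)//; apply/seteqP; split=> // s.
  by rewrite /= in_itv/= => /time_inverse_lt[]; rewrite ltNge c0.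
rewrite (_ : _ @^-1` _ = `[0%E, (rho c)%:E[%classic).
  exact: emeasurable_itv.
apply/seteqP; split=> s /=; rewrite !in_itv/=; first by move=> /time_inverse_lt[].
by move=> ?; apply/time_inverse_lt.
Qed.

End TimeChange.

(** * Passage times of continuous processes as random variables *)

Section Measurability.
Context d (T : measurableType d) (R : realType).

Lemma measurable_fun_dsube (f g : T -> \bar R) :
  measurable_fun setT f -> measurable_fun setT g ->
  measurable_fun setT (fun w => (f w - g w)%dE).
Proof.
move=> mf mg; under eq_fun do rewrite DualAddTheoryNumDomain.dual_addeE oppeK.
apply: measurableT_comp => //; apply: emeasurable_funD => //.
exact: measurableT_comp.
Qed.

Variable X : R -> T -> R.
Hypothesis mX : forall t, 0 <= t -> measurable_fun setT (X t).
Hypothesis cX : forall w, {within `[0, +oo[, continuous (X ^~ w)}.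

(* By compactness the level is hit on [q, r] iff it is approached along a
   countable dense set of times; the truncation at r keeps the endpoint. *)
Lemma hits_itvE (a q r : R) : 0 <= q -> q <= r ->
  [set w | exists2 s, q <= s <= r & X s w = a] =
  \bigcap_(k : nat) \bigcup_(p : rat)
    [set w | q <= ratr p /\ `|X (Num.min r (ratr p)) w - a| < k.+1%:R^-1].
Proof.
move=> q0 qr; apply/seteqP; split=> w.
  move=> [s /andP[qs sr] xs] k _.
  (* A right limit suffices, since the rational time is taken just above [s]; it also exists at
     [s = 0]. *)
  have : X u w @[u --> s^'+] --> X s w.
    have [cw cw0] := (continuous_within_itvcyP _ _).1 (cX (w := w)).
    have := le_trans q0 qs; rewrite le_eqVlt => /orP[/eqP <-//|s0].
    by apply: cvg_at_right_filter; apply: cw; rewrite in_itv/= s0.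
  move=> /cvgrPdist_lt/(_ k.+1%:R^-1); rewrite invr_gt0 ltr0n => /(_ isT).
  move=> [e /= e0 he].
  have /rat_in_itvoo[p] : s < s + e by rewrite ltrDl.
  rewrite in_itv/= => /andP[sp pse]; exists p => //=; split.
    by rewrite ltW// (le_lt_trans qs).
  move: sr; rewrite le_eqVlt => /orP[/eqP sr|sr].
    by rewrite -sr min_l ?ltW// xs subrr normr0.
  rewrite -xs distrC; apply: he; last by rewrite lt_min sr.
  have sm : s < Num.min r (ratr p) by rewrite lt_min sr.
  rewrite /= ltr0_norm ?subr_lt0// opprB ltrBlDl gt_min.
  by rewrite pse orbT.
move=> h.
have cw : {within `[q, r], continuous (fun t => `|X t w - a|)}.
  have : {within `[q, r], continuous (X ^~ w)}.
    apply: continuous_subspaceW (cX (w := w)) => t /=.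
    by rewrite !in_itv/= andbT => /andP[/(le_trans q0)].
  move=> c t; apply: cvg_norm; apply: cvgB; [exact: c|exact: cvg_cst].
have [s + smin] := EVT_min qr cw.
rewrite in_itv/= => qsr; exists s => //.
apply/eqP; rewrite -subr_eq0 -normr_eq0; apply: contraT => s0.
have {}s0 : 0 < `|X s w - a| by rewrite lt_neqAle eq_sym s0/=.
(* This [k] makes [1 / (k + 1)] smaller than the supposedly positive minimum, so no time in [[q, r]]
   can be that close to the level. *)
have [p _ [qp]] := h (Num.truncn `|X s w - a|^-1) I.
rewrite ltNge => /negP[]; apply: le_trans (smin _ _); last first.
  by rewrite in_itv/= le_min qr qp/= ge_min lexx.
rewrite -[leRHS]invrK lef_pV2 ?posrE ?invr_gt0//; apply/ltW.
by rewrite truncnS_gt.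
Qed.

Lemma measurable_hits_itv (a q r : R) : 0 <= q ->
  measurable [set w | exists2 s, q <= s <= r & X s w = a].
Proof.
move=> q0; have [qr|rq] := leP q r; last first.
  rewrite (_ : mkset _ = set0)//; apply/seteqP; split => // w [s].
  by move=> /andP[+ /(le_trans _)] => /[swap] /[apply]; rewrite leNgt rq.
rewrite hits_itvE//; apply: bigcapT_measurable => k.
apply: bigcupT_measurable_rat => p.
have [qp|qp] := boolP (q <= ratr p); last first.
  by rewrite (_ : mkset _ = set0)//; apply/seteqP; split => // w [].
have m : measurable_fun setT (fun w => `|X (Num.min r (ratr p)) w - a|).
  apply: measurableT_comp => //; apply: measurable_funB => //.
  by apply: mX; rewrite le_min !(le_trans q0).
rewrite (_ : mkset _ = setT `&`
  (fun w => `|X (Num.min r (ratr p)) w - a|) @^-1` `]-oo, k.+1%:R^-1[%classic).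
  by apply: m.
by apply/seteqP; split => w /=; rewrite in_itv/= => -[].
Qed.

Lemma measurable_passage_time (a : R) n :
  measurable_fun setT (fun w => passage_time a (X ^~ w) n).
Proof.
elim: n => [|n ih]; first exact: measurable_cst.
apply: (measurability _ (@ErealGenInftyO.measurableE R)) => _ [_ [c ->] <-].
rewrite setTI.
(* A hit strictly between the previous passage and [c] lies in a compact interval with rational
   endpoints strictly between them. *)
rewrite (_ : _ @^-1` _ = \bigcup_(q : rat) \bigcup_(r : rat)
  ([set w | (passage_time a (X ^~ w) n < (ratr q)%:E)%E] `&`
   [set w | ratr r < c /\ exists2 s, ratr q <= s <= ratr r & X s w = a])).
  apply: bigcupT_measurable_rat => q; apply: bigcupT_measurable_rat => r.
  have [q0|q0] := leP 0 (ratr q : R); last first.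
    rewrite (_ : mkset _ = set0) ?set0I//; apply/seteqP; split => // w /=.
    rewrite ltNge (le_trans _ (passage_time_ge0 _ _ _))//.
    by rewrite lee_fin ltW.
  have [rc|rc] := boolP (ratr r < c); last first.
    by rewrite [X in _ `&` X](_ : _ = set0) ?setI0//; apply/seteqP; split => // w [].
  apply: measurableI.
    rewrite -[X in measurable X]setTI.
    have := ih measurableT _ (emeasurable_itv `]-oo, (ratr q)%:E[).
    congr (measurable (setT `&` _)); apply/seteqP; split=> w /=; by rewrite in_itv.
  have := @measurable_hits_itv a _ (ratr r) q0.
  by congr measurable; apply/seteqP; split => w //= -[].
apply/seteqP; split=> w /=.
  rewrite in_itv/= => /passage_timeS_lt[t [+ tc xt]].
  case E : (passage_time _ _ _) (passage_time_ge0 a (X ^~ w) n) => [u| |]// _.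
  rewrite lte_fin => ut.
  have [q] := rat_in_itvoo ut; rewrite in_itv/= => /andP[uq qt].
  have [r] := rat_in_itvoo tc; rewrite in_itv/= => /andP[tr rc].
  exists q => //; exists r => //; split; first by rewrite /= E lte_fin.
  by split => //; exists t => //; rewrite !ltW.
move=> [q _ [r _ [/= nq [rc [s /andP[qs sr] xs]]]]].
rewrite in_itv/=; apply/passage_timeS_lt; exists s; split => //.
  by apply: lt_le_trans nq _; rewrite lee_fin.
exact: le_lt_trans sr rc.
Qed.

Lemma measurable_interpassage_time (a : R) n :
  measurable_fun setT (fun w => interpassage_time a (X ^~ w) n).
Proof.
rewrite /interpassage_time; case: (n <= 1)%N; first exact: measurable_passage_time.
by apply: measurable_fun_dsube; exact: measurable_passage_time.
Qed.

End Measurability.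

(** * Transfer to distributions and conclusion *)

Lemma distribution_image_comp d d1 d2 (T : measurableType d)
    (T1 : measurableType d1) (T2 : measurableType d2) (R : realType)
    (P : probability T R) (X : T -> T2) (g : T1 -> T2) (Y : T -> T1) :
  measurable_fun setT g -> measurable_fun setT Y -> (forall w, X w = g (Y w)) ->
  distribution_image P X g Y.
Proof.
move=> mg mY /funext ->; split => //.
exact: (measurableT_comp mg mY).
Qed.

Theorem mainTheorem3 (d : measure_display) (T : measurableType d)
    (R : realType) (P : probability T R) (B : R -> T -> R) (rho : R -> R)
    (z a : R)
    (hB : standard_brownian_motion P B)
    (rho_ge0 : forall t : R, 0 <= t -> 0 <= rho t)
    (rho_incr : {in `[0, +oo[ &, {homo rho : s t / s < t}})
    (rho_diff : differentiable_on_nonneg rho)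
    (rho0 : rho 0 = 0)
    (hza : z < a) :
  let tau n w := passage_time a (fun t => z + B (rho t) w) n in
  let Ti n w := interpassage_time a (fun t => z + B (rho t) w) n in
  let tauB n w := passage_time a (fun s => z + B s w) n in
  let TiB n w := interpassage_time a (fun s => z + B s w) n in
  let rho_inv := time_inverse rho in
  [/\ forall n w, (1 <= n)%N -> tau n w = rho_inv (tauB n w),
      forall w, Ti 1%N w = rho_inv (tauB 1%N w),
      forall n w, (2 <= n)%N ->
        Ti n w = (rho_inv (tauB n w) - rho_inv (tauB n.-1 w))%dE,
      forall n, (1 <= n)%N -> distribution_image P (tau n) rho_inv (tauB n) &
      forall n, (1 <= n)%N ->
        distribution_image P (Ti n)
          (fun su => (rho_inv su.1 - rho_inv (su.1 - su.2)%E)%dE)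
          (fun w => (tauB n w, TiB n w))].
Proof.
move=> tau Ti tauB TiB rho_inv.
have rho_cont := differentiable_on_nonneg_continuous rho0 rho_diff.
have mX t : 0 <= t -> measurable_fun setT (fun w => z + B t w).
  by move=> t0; apply: measurable_funD => //; exact: bm_measurable hB _ t0.
have cX w : {within `[0, +oo[, continuous (fun t => z + B t w)}.
  by move=> t; apply: cvgD; [exact: cvg_cst|exact: (bm_continuous hB)].
have mtauB n : measurable_fun setT (tauB n).
  exact: (measurable_passage_time mX cX).
have mTiB n : measurable_fun setT (TiB n).
  exact: (measurable_interpassage_time mX cX).
have mrhoV : measurable_fun setT rho_inv by exact: measurable_time_inverse.
have tauE n w : tau n w = rho_inv (tauB n w).
  exact: (passage_time_change rho_incr rho0 rho_cont a (fun s => z + B s w)).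
split.
- by move=> n w _; exact: tauE.
- by move=> w; exact: (tauE 1%N w).
- move=> n w.
  exact: (interpassage_time_changeS rho_incr rho0 rho_cont a
    (fun s => z + B s w)).
- by move=> n _; exact: distribution_image_comp (tauE n).
(* The joint law of [tauB n] and [TiB n] enters here, as the change of clock depends on when the
   interval ends and not only on its length. *)
- move=> n n1; apply: distribution_image_comp.
  + apply: measurable_fun_dsube; apply: measurableT_comp => //.
    by apply: emeasurable_funB.
  + exact: measurable_fun_pair.
  + move=> w; exact: (interpassage_time_changeE rho_incr rho0 rho_cont a
      (fun s => z + B s w)).
Qed.
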